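(* Let $n \in \mathbb{N}$, let $F$ be a field, let $\mathcal{A}$ be a commuting set of triangularizable matrices in $M_n(F)$, let $\mathcal{N}$ be the set of all nilpotent matrices in $M_n(F)$, and let $\mathcal{S}$ be a semigroup in $M_n(F)$ consisting of matrices of the form $A + N$, where $A \in \mathcal{A}$ and $N \in \mathcal{A}' \cap \mathcal{N}$. Then the semigroup $\mathcal{S}$ is triangularizable.
   Context: A semigroup in $M_n(F)$ is a set of $n\times n$ matrices over $F$ closed under multiplication. For a collection $\mathcal{C} \subseteq M_n(F)$, its commutant is $\mathcal{C}' = \{A \in M_n(F) : AB = BA \text{ for all } B \in \mathcal{C}\}$. A collection $\mathcal{C} \subseteq M_n(F)$ is (simultaneously) triangularizable if there is a chain of subspaces $\{0\} = \mathcal{V}_0 \subseteq \mathcal{V}_1 \subseteq \cdots \subseteq \mathcal{V}_n = F^n$ over $F$ with $\dim \mathcal{V}_j = j$ and each $\mathcal{V}_j$ invariant under every member of $\mathcal{C}$; a single matrix $A$ is triangularizable if $\{A\}$ is. A commuting set of triangularizable matrices is a set of pairwise commuting matrices each of which is triangularizable (over $F$). *)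

(* Defs.v *)
From mathcomp Require Import all_boot all_order all_algebra.

Set Implicit Arguments.
Unset Strict Implicit.
Unset Printing Implicit Defensive.

Import GRing.Theory.
Local Open Scope ring_scope.

(* Collections of matrices may be infinite and undecidable: they are
   Prop-valued predicates. *)
Definition mxset (F : fieldType) (n : nat) : Type := 'M[F]_n -> Prop.

Definition mx_semigroup (F : fieldType) (n : nat) (S : mxset F n) : Prop :=
  forall A B : 'M[F]_n, S A -> S B -> S (A *m B).

Definition commutant (F : fieldType) (n : nat) (C : mxset F n) : mxset F n :=
  fun A => forall B : 'M[F]_n, C B -> comm_mx A B.

Definition nilpotent_mx (F : fieldType) (n : nat) : mxset F n :=
  fun A => exists k : nat, A ^+ k = 0.

(* Matrices act on the left on column vectors; the chain V_0, ..., V_n is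
   indexed by 'I_n.+1. *)
Definition triangularizable (F : fieldType) (n : nat) (C : mxset F n) : Prop :=
  exists V : 'I_n.+1 -> {vspace 'cV[F]_n},
    [/\ V ord0 = 0%VS,
        V ord_max = fullv,
        forall i j : 'I_n.+1, (i <= j)%N -> (V i <= V j)%VS,
        forall j : 'I_n.+1, \dim (V j) = j
      & forall (A : 'M[F]_n) (j : 'I_n.+1) (v : 'cV[F]_n),
          C A -> v \in V j -> A *m v \in V j].

Definition triangularizable_mx (F : fieldType) (n : nat) (A : 'M[F]_n) : Prop :=
  triangularizable (fun B : 'M[F]_n => B = A).

Definition commuting_triangularizable (F : fieldType) (n : nat)
    (C : mxset F n) : Prop :=
  (forall A B : 'M[F]_n, C A -> C B -> comm_mx A B) /\
  (forall A : 'M[F]_n, C A -> triangularizable_mx A).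

(* Main.v *)
Require Import Defs.
From Stdlib Require Import Classical.
From mathcomp Require Import all_boot all_order all_algebra all_field.

(** Why the theorem is true.

    Cut the space down until nothing is left to cut.  As long as some member
    A of the commuting family is not a scalar, the kernel of A - r, for an
    eigenvalue r of A, is a proper nonzero subspace invariant under the family
    and under its commutant, hence under S; the hypotheses pass to the
    restriction and to the quotient.  Once the family consists of scalars,
    every member of S is a scalar plus a nilpotent, and everything rests on
    the theorem of Kaplansky that such a semigroup has a common eigenvector,
    over any field ([scalar_nilpotent_eigenvector]).

    That theorem is obtained from a version of the theorem of Burnside
    ([burnside]): in dimension at least 2, either S leaves invariant a proper
    nonzero subspace after some extension of scalars, or no nonzero matrix x
    satisfies tr (x s) = 0 for all s in S.  In the first case, induction on
    the dimension yields an eigenvector over the extension; its eigenvalues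
    lie in the ground field F, because they are forced by the decompositions
    scalar + nilpotent, so applying an F-linear functional to the coordinates
    gives an eigenvector over F.  In the second case, traces finish the proof,
    as a scalar a plus a nilpotent has trace n a:
    - if all members of S are nilpotent, or all are unipotent, with common
      eigenvalue c, then tr ((s - c) t) = n c - c (n c) = 0, so s = c
      ([idempotent_eigenvector], which covers the theorems of Levitzki and
      of Kolchin at once since c is 0 or 1);
    - in general n is not zero in F, for otherwise all traces vanish; the only
      nilpotent in S is 0; and the invertible members of S act on the
      trace-zero matrices by conjugation, unipotently.  By the unipotent case
      some nonzero trace-zero z is fixed, that is, commutes with S.  Then z
      commutes with every matrix, so it is scalar, and its trace n z cannot
      vanish: a contradiction.

    Burnside itself follows by descent on the rank of a nonzero t in the span
    of S.  If the rank exceeds 1, some t a t - z t has smaller rank and is not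
    zero, where z is an eigenvalue of a t on the range of t; only here does
    the field have to be extended.  When t has rank 1, irreducibility
    makes the traces against the span detect every matrix.

    Matrices act on row vectors throughout, where invariant subspaces are row
    spaces; a lower triangular form is then turned into a flag of column
    spaces. *)

Set Implicit Arguments.
Unset Strict Implicit.
Unset Printing Implicit Defensive.

Import GRing.Theory.
Local Open Scope ring_scope.

(** * Field extensions with enough linear functionals *)

(** All that is used of an extension L of F is that F-linear functionals
    L -> F separate points.  Unlike a structure of finite extension, this
    composes without any choice of an F-structure on the top field. *)
Definition separated (F L : fieldType) (f : {rmorphism F -> L}) : Prop :=
  forall x : L, x != 0 -> exists phi : L -> F,
    [/\ {morph phi : a b / a + b}, forall a b, phi (f a * b) = a * phi b
      & phi x != 0].

Lemma separated_id (F : fieldType) : separated (@idfun F).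
Proof. by move=> x nzx; exists id. Qed.

Lemma separated_comp (F L M : fieldType) (f : {rmorphism F -> L})
    (g : {rmorphism L -> M}) :
  separated f -> separated g -> separated (g \o f).
Proof.
move=> sf sg x /sg[psi [psiD psiZ /sf[phi [phiD phiZ nz]]]].
exists (phi \o psi); split=> // a b /=; first by rewrite psiD phiD.
by rewrite psiZ phiZ.
Qed.

Lemma separated_in_alg (F : fieldType) (L : fieldExtType F) :
  separated (GRing.in_alg L).
Proof.
move=> x nzx; pose X := vbasis {:L}.
have [i nzi] : exists i, coord X i x != 0.
  apply/existsP; apply: contraNT nzx; rewrite negb_exists => /forallP x0.
  rewrite (coord_vbasis (memvf x)) big1 // => i _.
  by have /negPn/eqP-> := x0 i; rewrite scale0r.
exists (coord X i); split=> // a b; first by rewrite linearD.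
by rewrite /= mulr_algl linearZ.
Qed.

Lemma irreducible_factor (F : fieldType) (p : {poly F}) :
  (1 < size p)%N -> exists2 q, irreducible_poly q & q %| p.
Proof.
elim: {p}(size p) {-2}p (leqnn (size p)) => [|n IHn] p.
  by rewrite leqn0 => /eqP->.
move=> lep szp; case: (classic (irreducible_poly p)) => [|redp]; first by exists p.
have [q [qp szq neq]] : exists q, [/\ q %| p, size q != 1%N & ~~ (q %= p)].
  apply: NNPP => noq; apply: redp; split=> // q szq qp.
  by apply: contraT => neq; case: noq; exists q.
have nzp : p != 0 by rewrite -size_poly_gt0 ltnW.
have nzq : q != 0 by apply: contraNneq nzp => q0; rewrite -dvd0p -q0.
have ltqp : (size q < size p)%N.
  by rewrite ltn_neqAle dvdp_leq // andbT dvdp_size_eqp.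
have [||r irr rq] := IHn q; first by rewrite -ltnS (leq_trans ltqp).
  by rewrite ltn_neqAle eq_sym szq size_poly_gt0.
by exists r => //; apply: dvdp_trans qp.
Qed.

(** The root comes from adjoining one of an irreducible factor. *)
Lemma separated_root (F : fieldType) (p : {poly F}) : (1 < size p)%N ->
  exists (L : fieldType) (f : {rmorphism F -> L}) (z : L),
    separated f /\ root (map_poly f p) z.
Proof.
move=> /irreducible_factor[q irr /dvdpP[r ->]].
have [L _ [z qz _]] := irredp_FAdjoin irr.
exists L, (GRing.in_alg L), z; split; first exact: separated_in_alg.
by rewrite rmorphM rootM qz orbT.
Qed.

Lemma separated_eigenvector (F : fieldType) (n : nat) (A : 'M[F]_n) :
  (0 < n)%N -> exists (L : fieldType) (f : {rmorphism F -> L}) (z : L),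
    separated f /\ exists2 v : 'rV_n, v *m map_mx f A = z *: v & v != 0.
Proof.
move=> n_gt0; have [|L [f [z [sf rz]]]] := @separated_root F (char_poly A).
  by rewrite size_char_poly ltnS.
exists L, f, z; split=> //; apply/eigenvalueP.
by rewrite eigenvalue_root_char -map_char_poly.
Qed.

(** Apply to the coordinates of v an F-linear functional that does not kill
    one of them: it commutes with matrices over F and with the eigenvalues,
    which lie in F. *)
Lemma separated_descent (F L : fieldType) (f : {rmorphism F -> L}) n
    (v : 'rV[L]_n) : separated f -> v != 0 ->
  exists2 w : 'rV[F]_n, w != 0 & forall (A : 'M_n) a,
    v *m map_mx f A = f a *: v -> w *m A = a *: w.
Proof.
move=> sf /rV0Pn[j nzj].
have [phi [phiD phiZ nzphi]] := sf _ nzj.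
exists (map_mx phi v).
  by apply: contraNneq nzphi => /rowP/(_ j); rewrite !mxE => ->.
move=> A a /rowP vA; apply/rowP=> i; have := congr1 phi (vA i).
have phi0 : phi 0 = 0 by rewrite -[in LHS](mul0r 0) -(rmorph0 f) phiZ mul0r.
rewrite !mxE phiZ => <-; rewrite (big_morph phi phiD phi0).
by apply: eq_bigr => k _; rewrite !mxE mulrC -phiZ mulrC.
Qed.

(** * A Burnside theorem up to extension of scalars *)

Inductive mxspan (F : fieldType) (n : nat) (S : mxset F n) : mxset F n :=
| mxspan0 : mxspan S 0
| mxspan_gen A : S A -> mxspan S A
| mxspan_lin a A B : mxspan S A -> mxspan S B -> mxspan S (a *: A + B).

Lemma mxspanM (F : fieldType) n (S : mxset F n) A B :
  mx_semigroup S -> mxspan S A -> mxspan S B -> mxspan S (A *m B).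
Proof.
move=> SM SA; elim: SA B => [|{}A SA|a A1 A2 _ IH1 _ IH2] B SB.
- by rewrite mul0mx; apply: mxspan0.
- elim: SB => [| {}B SB | b B1 B2 _ IH1 _ IH2].
  + by rewrite mulmx0; apply: mxspan0.
  + exact/mxspan_gen/SM.
  + by rewrite mulmxDr -scalemxAr; apply: mxspan_lin.
- by rewrite mulmxDl -scalemxAl; apply: mxspan_lin; [apply: IH1|apply: IH2].
Qed.

(** The matrix is reached by adding rows to a matrix whose row space is in P
    until the rank stops growing. *)
Lemma subspace_row_space (F : fieldType) n (P : 'rV[F]_n -> Prop) :
  P 0 -> (forall a u v, P u -> P v -> P (a *: u + v)) ->
  exists W : 'M[F]_n, forall v, (v <= W)%MS <-> P v.
Proof.
move=> P0 Plin; suff [W [PW WP]] : exists W : 'M[F]_n,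
    (forall v : 'rV_n, (v <= W)%MS -> P v) /\ forall v, P v -> (v <= W)%MS.
  by exists W => v; split; [apply: PW | apply: WP].
have [W PW] : exists W : 'M[F]_n, forall v : 'rV_n, (v <= W)%MS -> P v.
  by exists 0 => v; rewrite submx0 => /eqP->.
elim: {W}(n - \rank W)%N {-2}W (leqnn (n - \rank W)) PW => [|k IHk] W.
  rewrite leqn0 subn_eq0 => fullW PW; exists W; split=> // v _.
  by rewrite submx_full // /row_full eqn_leq rank_leq_col.
move=> leW PW; case: (classic (forall v, P v -> (v <= W)%MS)) => [WP|].
  by exists W.
move=> nWP; have [v nv] := not_all_ex_not _ _ nWP.
have [Pv /negP vW] := imply_to_and _ _ nv.
apply: (IHk (W + v)%MS); last first.
  move=> u /sub_addsmxP[[x y] /= ->].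
  rewrite (mx11_scalar y) mul_scalar_mx addrC.
  by apply: Plin => //; apply: PW; rewrite submxMl.
have ltW : (\rank W < \rank (W + v))%N.
  rewrite ltn_neqAle mxrankS ?addsmxSl // andbT.
  apply: contra vW => eqr; apply: submx_trans (addsmxSr W v) _.
  by rewrite -(geq_leqif (mxrank_leqif_sup (addsmxSl W v))) (eqP eqr).
by rewrite -ltnS (leq_trans _ leW) // ltn_sub2l // (leq_trans ltW) // rank_leq_col.
Qed.

Definition mx_image (F L : fieldType) n k (phi : 'M[F]_n -> 'M[L]_k)
  (S : mxset F n) : mxset L k := fun B => exists2 A, S A & B = phi A.

(** Reducibility over some extension.  Quantifying over the extensions replaces
    an algebraic closure. *)
Definition sep_reducible (F : fieldType) n (S : mxset F n) : Prop :=
  exists (L : fieldType) (f : {rmorphism F -> L}) (m : nat) (W : 'M[L]_(m, n)),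
    [/\ separated f, W != 0, (\rank W < n)%N
      & forall A, S A -> stablemx W (map_mx f A)].

(** Over a field this says that S spans all matrices. *)
Definition trace_nondegenerate (F : fieldType) n (S : mxset F n) : Prop :=
  forall x : 'M[F]_n, (forall A, S A -> \tr (x *m A) = 0) -> x = 0.

Lemma map_mx_semigroup (F L : fieldType) (f : {rmorphism F -> L}) n
  (S : mxset F n) : mx_semigroup S -> mx_semigroup (mx_image (map_mx f) S).
Proof.
move=> SM _ _ [A SA ->] [B SB ->]; rewrite -map_mxM.
by exists (A *m B) => //; apply: SM.
Qed.

Lemma map_mxspan (F L : fieldType) (f : {rmorphism F -> L}) n
  (S : mxset F n) A : mxspan S A -> mxspan (mx_image (map_mx f) S) (map_mx f A).
Proof.
elim=> [|{}A SA|a A1 A2 _ IH1 _ IH2]; first by rewrite map_mx0; apply: mxspan0.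
  by apply: mxspan_gen; exists A.
by rewrite map_mxD map_mxZ; apply: mxspan_lin.
Qed.

Lemma sep_reducible_map (F L : fieldType) (f : {rmorphism F -> L}) n
    (S : mxset F n) :
  separated f -> sep_reducible (mx_image (map_mx f) S) -> sep_reducible S.
Proof.
move=> sf [M [g [m [W [sg nzW ltW WS]]]]]; exists M, (g \o f), m, W.
split=> // [|A SA]; first exact: separated_comp.
by rewrite map_mx_comp; apply: WS; exists A.
Qed.

Lemma trace_nondegenerate_map (F L : fieldType) (f : {rmorphism F -> L}) n
    (S : mxset F n) :
  trace_nondegenerate (mx_image (map_mx f) S) -> trace_nondegenerate S.
Proof.
move=> ndS x trx; apply/eqP; rewrite -(map_mx_eq0 f); apply/eqP/ndS.
by move=> _ [A SA ->]; rewrite -map_mxM trace_map_mx trx ?rmorph0.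
Qed.

Lemma row_neq0 (F : fieldType) m n (A : 'M[F]_(m, n)) :
  A != 0 -> exists i, row i A != 0.
Proof.
move=> /matrix0Pn[i [j nzij]]; exists i; apply/rV0Pn; exists j.
by rewrite mxE.
Qed.

Lemma irreducible_row_full (F : fieldType) n (S : mxset F n) m
    (W : 'M[F]_(m, n)) :
  ~ sep_reducible S -> W != 0 -> (forall A, S A -> stablemx W A) -> row_full W.
Proof.
move=> irrS nzW WS; apply: contraT => nfW; case: irrS.
exists F, idfun, m, W; split=> // [||A /WS]; first exact: separated_id.
  by rewrite ltn_neqAle nfW rank_leq_col.
by rewrite map_mx_id.
Qed.

(** The orbit of u under the span of S is an invariant subspace, so it is
    everything unless it vanishes. *)
Lemma mxspan_transitive (F : fieldType) n (S : mxset F n) (u v : 'rV[F]_n) :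
  (1 < n)%N -> mx_semigroup S -> ~ sep_reducible S -> u != 0 ->
  exists2 A, mxspan S A & u *m A = v.
Proof.
move=> n_gt1 SM irrS nzu.
have [|a v1 v2 [A SA <-] [B SB <-]|W WP] :=
    @subspace_row_space F n (fun w => exists2 A, mxspan S A & u *m A = w).
- by exists 0; [apply: mxspan0 | rewrite mulmx0].
- by exists (a *: A + B); [apply: mxspan_lin | rewrite mulmxDr scalemxAr].
apply/WP/submx_full/(irreducible_row_full irrS) => [|A SA]; last first.
  apply/row_subP=> i; rewrite row_mul; apply/WP.
  have /WP[B SB <-] := row_sub i W; rewrite -mulmxA.
  by exists (B *m A) => //; apply: mxspanM => //; apply: mxspan_gen.
(* If [u] were killed by [S], its line would be a proper invariant subspace. *)
apply/eqP=> W0; have u0 A : S A -> u *m A = 0.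
  move=> SA; apply/eqP; rewrite -submx0 -W0.
  by apply/WP; exists A => //; apply: mxspan_gen.
suff : row_full u by rewrite /row_full rank_rV nzu ltn_eqF.
by apply: irreducible_row_full irrS nzu _ => A /u0->; apply: sub0mx.
Qed.

Lemma rank1_factor (F : fieldType) n (t : 'M[F]_n) : \rank t = 1%N ->
  exists (c : 'cV_n) (y : 'rV_n), t = c *m y.
Proof.
move=> rk1; suff: exists (c : 'cV_n) (y : 'rV_n), col_base t *m row_base t = c *m y.
  by rewrite mulmx_base.
by move: (col_base t) (row_base t); rewrite rk1 => c y; exists c, y.
Qed.

(** If t = c y and tr (x a t b) = 0 for all a, b in the span, then
    (y b) x (a c) = 0; transitivity makes y b arbitrary, and makes the row
    y b x times a arbitrary as soon as it is not zero, which forces c = 0. *)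
Lemma trace_nondegenerate_rank1 (F : fieldType) n (S : mxset F n)
    (t : 'M[F]_n) :
  (1 < n)%N -> mx_semigroup S -> ~ sep_reducible S -> mxspan S t ->
  \rank t = 1%N -> trace_nondegenerate S.
Proof.
move=> n_gt1 SM irrS St rk1 x trx; have [c [y tE]] := rank1_factor rk1.
have nzt : t != 0 by rewrite -mxrank_eq0 rk1.
have nzy : y != 0 by apply: contraNneq nzt => y0; rewrite tE y0 mulmx0.
have {}trx A : mxspan S A -> \tr (x *m A) = 0.
  elim=> [|//|a A1 A2 _ IH1 _ IH2]; first by rewrite mulmx0 mxtrace0.
  by rewrite mulmxDr -scalemxAr mxtraceD mxtraceZ IH1 IH2 mulr0 addr0.
apply: contraTeq nzt => nzx; rewrite negbK.
have [i nzi] := row_neq0 nzx.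
have [B SB yB] := mxspan_transitive (delta_mx 0 i) n_gt1 SM irrS nzy.
suff c0 : c = 0 by rewrite tE c0 mul0mx.
apply/colP=> j.
have [A SA xA] := mxspan_transitive (delta_mx 0 j) n_gt1 SM irrS nzi.
have : \tr (x *m (A *m t *m B)) = 0 by apply: trx; do 2?apply: mxspanM.
rewrite tE -!mulmxA mulmxA mxtrace_mulC -!mulmxA (mulmxA y) yB mulmxA -rowE.
by rewrite xA mxtrace_mulC -rowE [row _ _]mx11_scalar mxtrace_scalar !mxE.
Qed.

(** If t has rank at least 2, take row vectors with independent images under t
    and a in the span sending the first image to the second.  For an
    eigenvalue z of a t on the range of t, the matrix t (a t - z) is nonzero
    because of that independence, and has a larger kernel than t because the
    eigenvector is of the form y t. *)
Lemma burnside_rank (r n : nat) (F : fieldType) (S : mxset F n) (t : 'M[F]_n) :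
  (1 < n)%N -> mx_semigroup S -> mxspan S t -> t != 0 -> (\rank t <= r)%N ->
  sep_reducible S \/ trace_nondegenerate S.
Proof.
move=> n_gt1; elim: r F S t => [|r IHr] F S t SM St nzt.
  by rewrite leqn0 mxrank_eq0 (negPf nzt).
move=> lert; have [|irrS] := classic (sep_reducible S); first by left.
have [rk1|rk1] := eqVneq (\rank t) 1%N.
  by right; apply: trace_nondegenerate_rank1 rk1.
have rk_gt1 : (1 < \rank t)%N by rewrite ltn_neqAle eq_sym rk1 lt0n mxrank_eq0.
have [i nzi] := row_neq0 nzt.
have [j nj] : exists j, ~~ (row j t <= row i t)%MS.
  apply/existsP; apply: contraLR rk_gt1; rewrite negb_exists => /forallP tP.
  rewrite -leqNgt (leq_trans _ (rank_leq_row (row i t))) ?mxrankS //.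
  by apply/row_subP=> j; have := tP j; rewrite negbK.
have [a Sa ia] := mxspan_transitive (delta_mx 0 j) n_gt1 SM irrS nzi.
(* The operator [a *m t] acts on the row space of [t]; extend the field to
   give it an eigenvector. *)
have stab : stablemx (row_base t) (a *m t).
  by rewrite stablemx_row_base mulmxA submxMl.
have [|L [f [z [sf [u uC nzu]]]]] :=
    @separated_eigenvector F _ (restrictmx t (a *m t)).
  by rewrite (ltn_trans _ rk_gt1).
pose B := map_mx f (row_base t).
have wE : u *m B *m map_mx f (a *m t) = z *: (u *m B).
  by rewrite scalemxAl -uC -!mulmxA -!map_mxM /conjmx mulmxKpV.
have nzw : u *m B != 0.
  by rewrite mulmx_free_eq0 // /row_free mxrank_map; apply: row_base_free.
have /submxP[y yE] : (u *m B <= map_mx f t)%MS.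
  by rewrite (submx_trans (submxMl _ _)) // map_submx eq_row_base.
pose t' := map_mx f t *m (map_mx f (a *m t) - z%:M).
have t'E : t' = (- z) *: map_mx f t + map_mx f (t *m (a *m t)).
  by rewrite /t' mulmxBr -map_mxM mul_mx_scalar scaleNr addrC.
have [||||redS|ndS] := IHr L (mx_image (map_mx f) S) t'.
- exact: map_mx_semigroup.
- by rewrite t'E; apply: mxspan_lin; apply: map_mxspan => //; do 2?apply: mxspanM.
(* [t'] is not zero: otherwise row [j] of [t], the image of row [i] under
   [a *m t], would be proportional to row [i], first over [L], then over [F]. *)
- apply: contraNneq nj => t'0; rewrite -(map_submx f).
  have /eqP : row i t' = 0 by rewrite t'0 row0.
  rewrite t'E linearD /= linearZ /= -!map_row addrC scaleNr subr_eq0.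
  by rewrite row_mul mulmxA ia -rowE => /eqP->; apply: scalemx_sub.
- rewrite -ltnS (leq_trans _ lert) // -(mxrank_map f t).
  have le_n (X : 'M[L]_n) : (\rank X <= n)%N by apply: rank_leq_row.
  suff : (\rank (kermx (map_mx f t)) < \rank (kermx t'))%N.
    rewrite !mxrank_ker => lt_ker; rewrite ltnNge; apply/negP=> le_t.
    by move: lt_ker; rewrite ltnNge leq_sub2l.
  suff : (kermx (map_mx f t) < kermx t')%MS by rewrite ltmxErank => /andP[].
  apply/andP; split.
    by apply/sub_kermxP; rewrite mulmxA mulmx_ker mul0mx.
  apply: contra nzw => le_ker; rewrite yE -sub_kermx; apply: submx_trans le_ker.
  by apply/sub_kermxP; rewrite mulmxA -yE mulmxBr wE mul_mx_scalar subrr.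
- by left; apply: sep_reducible_map redS.
- by right; apply: trace_nondegenerate_map ndS.
Qed.

Lemma burnside (n : nat) (F : fieldType) (S : mxset F n) :
  (1 < n)%N -> mx_semigroup S -> sep_reducible S \/ trace_nondegenerate S.
Proof.
move=> n_gt1 SM; have [|irrS] := classic (sep_reducible S); first by left.
have n_gt0 := ltnW n_gt1; pose u : 'rV[F]_n := delta_mx 0 (Ordinal n_gt0).
have nzu : u != 0.
  by apply/eqP=> /rowP/(_ (Ordinal n_gt0))/eqP; rewrite !mxE !eqxx oner_eq0.
have [t St ut] := mxspan_transitive u n_gt1 SM irrS nzu.
apply: (burnside_rank n_gt1 SM St _ (leqnn _)).
by apply: contraNneq nzu => t0; rewrite -ut t0 mulmx0.
Qed.

(** * Nilpotent matrices *)

Lemma exprB_comm_nilp (R : pzRingType) (x y : R) k l :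
  GRing.comm x y -> x ^+ k = 0 -> y ^+ l = 0 -> (x - y) ^+ (k + l) = 0.
Proof.
move=> cxy xk yl; rewrite exprDn_comm; last exact: commrN.
rewrite big1 // => i _.
rewrite exprNn; have [lei|lti] := leqP l i.
  by rewrite -(subnK lei) [y ^+ _]exprD yl !mulr0 mul0rn.
have /subnK <- : (k <= k + l - i)%N by rewrite -addnBA ?leq_addr // ltnW.
by rewrite [x ^+ _]exprD xk mulr0 mul0r mul0rn.
Qed.

(** The characteristic polynomial is a power of the indeterminate, as a divisor
    of one: X - N divides X^k = X^k - N^k in the matrices over F[X]. *)
Lemma mxtrace_nilpotent (F : fieldType) n (N : 'M[F]_n) :
  nilpotent_mx N -> \tr N = 0.
Proof.
case: n N => [|n] N [k Nk]; first by rewrite /mxtrace big_ord0.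
suff charN : char_poly N = 'X^(n.+1).
  apply/eqP; rewrite -oppr_eq0 -char_poly_trace // charN coefXn.
  by rewrite (ltn_eqF (ltnSn n)).
pose M := map_mx polyC N.
have Mk : M ^+ k = 0 by rewrite -(rmorphXn (map_mx (@polyC F))) Nk rmorph0.
have /subrXX_comm-/(_ k) : GRing.comm ('X%:M : 'M[{poly F}]_n.+1) M.
  exact: esym (scalar_mxC _ _).
rewrite Mk subr0 => /(congr1 determinant); rewrite det_mulmx.
rewrite -(rmorphXn scalar_mx) det_scalar -exprM => charE.
have : char_poly N %| ('X - 0%:P) ^+ (k * n.+1).
  by rewrite polyC0 subr0 charE dvdp_mulIl.
move=> /dvdp_exp_XsubCP[j _]; rewrite polyC0 subr0.
rewrite eqp_monic ?char_poly_monic ?monicXn // => /eqP charN.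
by have := size_char_poly N; rewrite charN size_polyXn => -[->].
Qed.

Lemma mxtrace_scalar_nilpotent (F : fieldType) n (A : 'M[F]_n) a :
  nilpotent_mx (A - a%:M) -> \tr A = a *+ n.
Proof.
move=> /mxtrace_nilpotent/eqP; rewrite raddfB /= mxtrace_scalar subr_eq0.
by move/eqP.
Qed.

Lemma nilpotent_eigenvalue (F : fieldType) n (N : 'M[F]_n) (v : 'rV_n) a :
  nilpotent_mx N -> v *m N = a *: v -> v != 0 -> a = 0.
Proof.
move=> [k Nk] vN nzv; suff vNk j : v *m N ^+ j = a ^+ j *: v.
  move: (vNk k); rewrite Nk mulmx0 => /esym/eqP; rewrite scaler_eq0 (negPf nzv).
  by rewrite orbF expf_eq0 => /andP[_ /eqP].
elim: j => [|j IHj]; first by rewrite !expr0 scale1r mulmx1.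
by rewrite exprS mulmxA vN -scalemxAl IHj scalerA -exprS.
Qed.

Lemma singular_kernel (F : fieldType) n (A : 'M[F]_n) :
  A \notin unitmx -> exists2 v : 'rV_n, v != 0 & v *m A = 0.
Proof.
by rewrite unitmxE unitfE negbK => /det0P[v nzv vA]; exists v.
Qed.

Lemma scalar_nilpotent_singular (F : fieldType) n (A : 'M[F]_n) a :
  nilpotent_mx (A - a%:M) -> A \notin unitmx -> a = 0.
Proof.
move=> nA /singular_kernel[v nzv vA]; apply/eqP; rewrite -oppr_eq0; apply/eqP.
apply: nilpotent_eigenvalue nA _ nzv.
by rewrite mulmxBr vA sub0r mul_mx_scalar scaleNr.
Qed.

Lemma nilpotent_singular (F : fieldType) n (A : 'M[F]_n) :
  (0 < n)%N -> nilpotent_mx A -> A \notin unitmx.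
Proof.
case: n A => // n A _ [k Ak]; apply/negP=> uA; have uAk j : A ^+ j \in unitmx.
  elim: j => [|j IHj]; first exact: unitmx1.
  by rewrite exprS unitmx_mul uA.
have := uAk k; rewrite Ak unitmxE det0 ?unitr0 //.
Qed.

(** * Restricting semigroups to subquotients *)

(** Passing to an invariant subspace or to its quotient is multiplicative only
    on the matrices that preserve the subspace.  Here C is such a set and phi
    such a passage, possibly after an extension f of scalars. *)
Definition partial_rep (F L : fieldType) (f : {rmorphism F -> L}) n k
    (C : mxset F n) (phi : 'M[F]_n -> 'M[L]_k) : Prop :=
  [/\ forall a, C a%:M /\ phi a%:M = (f a)%:M,
      forall A B, C A -> C B -> C (A - B) /\ phi (A - B) = phi A - phi B
    & forall A B, C A -> C B -> C (A *m B) /\ phi (A *m B) = phi A *m phi B].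

Lemma partial_rep_restrict (F L : fieldType) (f : {rmorphism F -> L}) n k
    (W : 'M[L]_(k, n)) : row_free W ->
  partial_rep f (fun A => stablemx W (map_mx f A))
    (fun A => conjmx W (map_mx f A)).
Proof.
move=> freeW; split=> [a|A B WA WB|A B WA WB].
- by rewrite map_scalar_mx stablemxC conjmx_scalar.
- by rewrite map_mxB stablemxD ?stablemxN // /conjmx mulmxBr mulmxBl.
- by rewrite map_mxM stablemxM // conjmxM.
Qed.

Section PartialRep.

Variables (F L : fieldType) (f : {rmorphism F -> L}) (n k : nat).
Variables (C : mxset F n) (phi : 'M[F]_n -> 'M[L]_k).
Hypothesis repC : partial_rep f C phi.

Lemma partial_rep_shift A a :
  C A -> C (A - a%:M) /\ phi (A - a%:M) = phi A - (f a)%:M.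
Proof.
case: repC => repa repB _ CA; have [Ca <-] := repa a.
exact: repB.
Qed.

Lemma partial_rep_prod (rs : seq F) A : C A ->
  C (\prod_(r <- rs) (A - r%:M)) /\
  phi (\prod_(r <- rs) (A - r%:M)) = \prod_(r <- map f rs) (phi A - r%:M).
Proof.
case: repC => repa _ repM CA; elim: rs => [|r rs [Crs phirs]].
  by have [C1 phi1] := repa 1; rewrite !big_nil phi1 rmorph1.
have [Cr phir] := partial_rep_shift r CA.
rewrite /= !big_cons; have [CM phiM] := repM _ _ Cr Crs.
by split=> //; rewrite phiM phir phirs.
Qed.

Lemma partial_rep0 : phi 0 = 0.
Proof. by case: repC => /(_ 0)[_]; rewrite rmorph0 !raddf0. Qed.

Lemma partial_rep_nilpotent A : C A -> nilpotent_mx A -> nilpotent_mx (phi A).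
Proof.
move=> CA [j Aj]; exists j; have [_] := partial_rep_prod (nseq j 0) CA.
rewrite map_nseq !big_nseq !iter_mulr_1 rmorph0 !raddf0 !addr0 Aj partial_rep0.
by move->.
Qed.

Lemma partial_rep_scalar_nilpotent A a :
  C A -> nilpotent_mx (A - a%:M) -> nilpotent_mx (phi A - (f a)%:M).
Proof.
move=> CA nA; have [Ca <-] := partial_rep_shift a CA.
exact: partial_rep_nilpotent.
Qed.

Lemma partial_rep_semigroup S :
  (forall A, S A -> C A) -> mx_semigroup S -> mx_semigroup (mx_image phi S).
Proof.
case: repC => _ _ repM SC SM _ _ [A SA ->] [B SB ->].
exists (A *m B); first exact: SM.
by have [_ ->] := repM _ _ (SC _ SA) (SC _ SB).
Qed.

End PartialRep.

(** * Common eigenvectors of semigroups of scalar plus nilpotent matrices *)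

(** What the inductions on the dimension need: the semigroup restricts to an
    invariant subspace over an extension, and eigenvectors found there are
    eigenvectors of the whole. *)
Lemma restrict_eigenvectors (F L : fieldType) (f : {rmorphism F -> L}) n m
    (S : mxset F n) (W : 'M[L]_(m, n)) :
  mx_semigroup S -> (forall A, S A -> stablemx W (map_mx f A)) ->
  let phi A := restrictmx W (map_mx f A) in
  [/\ mx_semigroup (mx_image phi S),
      forall A a, S A -> nilpotent_mx (A - a%:M) ->
        nilpotent_mx (phi A - (f a)%:M)
    & forall v : 'rV_(\rank W), v != 0 ->
        [/\ v *m row_base W != 0, (v *m row_base W <= W)%MS
          & forall A a, S A -> v *m phi A = a *: v ->
              v *m row_base W *m map_mx f A = a *: (v *m row_base W)]].
Proof.
move=> SM WS phi; have WS' A : S A -> stablemx (row_base W) (map_mx f A).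
  by rewrite stablemx_row_base; apply: WS.
have rep := partial_rep_restrict f (row_base_free W).
split=> [|A a /WS' WA|v nzv].
- exact: partial_rep_semigroup rep _ WS' SM.
- move=> nA; exact: (partial_rep_scalar_nilpotent rep WA nA).
split=> [||A a /WS' WA vA].
- by rewrite mulmx_free_eq0 ?row_base_free.
- by rewrite (submx_trans (submxMl _ _)) ?eq_row_base.
by rewrite scalemxAl -vA /phi /conjmx -[in RHS]mulmxA mulmxKpV // mulmxA.
Qed.

Lemma nilpotent1 (F : fieldType) n (A : 'M[F]_n) a :
  (n <= 1)%N -> nilpotent_mx (A - a%:M) -> A = a%:M.
Proof.
case: n A => [|[|//]] A _ nA; first by rewrite [A]flatmx0 [RHS]flatmx0.
have := mxtrace_scalar_nilpotent nA.
by rewrite [A]mx11_scalar mxtrace_scalar !mulr1n => ->.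
Qed.

Lemma rV_neq0 (F : fieldType) n : (0 < n)%N -> exists v : 'rV[F]_n, v != 0.
Proof.
case: n => // n _; exists (const_mx 1); apply/rV0Pn; exists ord0.
by rewrite mxE oner_eq0.
Qed.

(** The theorems of Levitzki (c = 0) and Kolchin (c = 1) together.  The
    condition c c = c is what makes tr ((s - c) t) = n c - c (n c) vanish. *)
Lemma idempotent_eigenvector n (F : fieldType) (c : F) (S : mxset F n) :
  (0 < n)%N -> c * c = c -> mx_semigroup S ->
  (forall A, S A -> nilpotent_mx (A - c%:M)) ->
  exists2 v : 'rV_n, v != 0 & forall A, S A -> v *m A = c *: v.
Proof.
have [N] := ubnP n; elim: N n F c S => // N IHN n F c S ltnN n_gt0 cc SM Snil.
(* In dimension 1, and when traces determine matrices, [S] reduces to [c];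
   otherwise an eigenvector comes from a smaller dimension. *)
suff [Sc|[v nzv vS]] : (forall A, S A -> A = c%:M) \/
    exists2 v : 'rV_n, v != 0 & forall A, S A -> v *m A = c *: v.
- have [v nzv] := rV_neq0 F n_gt0; exists v => // A /Sc->.
  by rewrite mul_mx_scalar.
- by exists v.
have [n_le1|n_gt1] := leqP n 1.
  by left=> A /Snil; apply: nilpotent1.
have [[L [f [m [W [sf nzW ltW WS]]]]]|ndS] := burnside n_gt1 SM; last first.
  have trS A : S A -> \tr A = c *+ n by move/Snil/mxtrace_scalar_nilpotent.
  left=> A SA; apply/eqP; rewrite -subr_eq0; apply/eqP/ndS => B SB.
  rewrite mulmxBl raddfB /= mul_scalar_mx mxtraceZ !trS //; last exact: SM.
  by rewrite mulrnAr cc subrr.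
right; have [SM' Snil' eigS] := restrict_eigenvectors SM WS.
have [||||v nzv vS] := IHN _ L (f c) _ _ _ _ SM'.
- by rewrite -ltnS (leq_trans _ ltnN).
- by rewrite lt0n mxrank_eq0.
- by rewrite -rmorphM cc.
- by move=> _ [A SA ->]; apply: Snil' => //; apply: Snil.
have [nzvW _ vW] := eigS v nzv.
have [w nzw wA] := separated_descent sf nzvW.
exists w => // A SA; apply: wA; apply: vW => //; apply: vS; by exists A.
Qed.

Lemma idempotent_eigenvector_in n m (F : fieldType) (c : F) (S : mxset F n)
    (W : 'M_(m, n)) :
  W != 0 -> (forall A, S A -> stablemx W A) -> c * c = c -> mx_semigroup S ->
  (forall A, S A -> nilpotent_mx (A - c%:M)) ->
  exists2 v : 'rV_n, v != 0 /\ (v <= W)%MS & forall A, S A -> v *m A = c *: v.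
Proof.
move=> nzW WS cc SM Snil.
have [|SM' Snil' eigS] := @restrict_eigenvectors F F idfun n m S W SM.
  by move=> A /WS; rewrite map_mx_id.
have [|_ [A SA ->]|v nzv vS] := idempotent_eigenvector _ cc SM'.
- by rewrite lt0n mxrank_eq0.
- by apply: Snil' => //; apply: Snil.
have [nzvW leW vW] := eigS v nzv.
exists (v *m row_base W) => // A SA; rewrite -[A in LHS](map_mx_id (f := idfun)) //.
by apply: vW => //; apply: vS; exists A.
Qed.

(** The next two lemmas specialize [mul_vec_lin] to fields, so that rewriting
    need not guess the ring structure. *)
Lemma mul_vec_mulmx (F : fieldType) n (A X : 'M[F]_n) :
  mxvec X *m lin_mulmx A = mxvec (A *m X).
Proof. exact: mul_vec_lin. Qed.

Lemma mul_vec_mulmxr (F : fieldType) n (A X : 'M[F]_n) :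
  mxvec X *m lin_mulmxr A = mxvec (X *m A).
Proof. exact: mul_vec_lin. Qed.

Definition mul_vec := (mul_vec_mulmx, mul_vec_mulmxr).

(** X goes to A^-1 X A, not to A X A^-1, so that products are respected when
    matrices act on row vectors from the right. *)
Definition conj_action (F : fieldType) n (A : 'M[F]_n) : 'M[F]_(n * n) :=
  lin_mulmx (invmx A) *m lin_mulmxr A.

Lemma mul_vec_conj (F : fieldType) n (A X : 'M[F]_n) :
  mxvec X *m conj_action A = mxvec (invmx A *m X *m A).
Proof. by rewrite mulmxA !mul_vec. Qed.

Lemma mxvec_eq (F : fieldType) m n p (M M' : 'M[F]_(m * n, p)) :
  (forall X : 'M_(m, n), mxvec X *m M = mxvec X *m M') -> M = M'.
Proof.
move=> eqM; apply/row_matrixP=> i.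
by rewrite !rowE -[delta_mx _ _]vec_mxK eqM.
Qed.

Lemma conj_actionM (F : fieldType) n (A B : 'M[F]_n) :
  A \in unitmx -> B \in unitmx ->
  conj_action (A *m B) = conj_action A *m conj_action B.
Proof.
move=> uA uB; apply: mxvec_eq => X; rewrite mulmxA !mul_vec_conj.
suff -> : invmx (A *m B) = invmx B *m invmx A by rewrite !mulmxA.
have uAB : A *m B \in unitmx by rewrite unitmx_mul uA.
by rewrite -[RHS](mulmxK uAB) !mulmxA mulmxKV // mulVmx // mul1mx.
Qed.

Lemma lin_mulmxrX (F : fieldType) n (N : 'M[F]_n) k :
  (lin_mulmxr N : 'M_(n * n)) ^+ k = lin_mulmxr (N ^+ k).
Proof.
elim: k => [|k IHk]; apply: mxvec_eq => X.
  by rewrite !expr0 mulmx1 mul_vec /= mulmx1.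
by rewrite !exprSr mulmxA IHk !mul_vec /= mulmxA.
Qed.

Lemma lin_mulmxX (F : fieldType) n (N : 'M[F]_n) k :
  (lin_mulmx N : 'M_(n * n)) ^+ k = lin_mulmx (N ^+ k).
Proof.
elim: k => [|k IHk]; apply: mxvec_eq => X.
  by rewrite !expr0 mulmx1 mul_vec /= mul1mx.
by rewrite exprSr exprS mulmxA IHk !mul_vec /= mulmxA.
Qed.

(** With A = a + N, conjugation minus the identity sends X to
    A^-1 (X N - N X).  The operator X N - N X is a difference of commuting
    nilpotents, hence nilpotent, and it commutes with multiplication by A^-1. *)
Lemma conj_action_unipotent (F : fieldType) n (A : 'M[F]_n) a :
  A \in unitmx -> nilpotent_mx (A - a%:M) ->
  nilpotent_mx (conj_action A - 1%:M).
Proof.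
move=> uA [k]; set N := A - a%:M => Nk.
have AE : A = a%:M + N by rewrite addrC subrK.
have AN : invmx A *m N = N *m invmx A.
  by rewrite /N mulmxBr mulmxBl mulVmx // mulmxV // scalar_mxC.
clearbody N.
pose D : 'M_(n * n) := lin_mulmxr N - lin_mulmx N.
have DE : conj_action A - 1%:M = lin_mulmx (invmx A) *m D.
  apply: mxvec_eq => X; rewrite mulmxBr mul_vec_conj mulmx1 mulmxA mul_vec.
  rewrite /D mulmxBr !mul_vec -!linearB /=; congr mxvec.
  rewrite -[X in _ - X](mulKVmx uA) {2 3}AE.
  by rewrite mulmxDr mulmxDl scalar_mxC opprD addrACA subrr add0r.
exists (k + k)%N; rewrite DE exprMn_comm; last first.
  apply: mxvec_eq => X; rewrite /D !mulmxA mul_vec !mulmxBr !mul_vec.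
  by rewrite mulmxBl !mul_vec !mulmxA AN.
rewrite [D ^+ _]exprB_comm_nilp ?mulr0 //.
- by apply: mxvec_eq => X; rewrite !mulmxA !mul_vec /= mulmxA.
- by rewrite lin_mulmxrX Nk linear0.
- by rewrite lin_mulmxX Nk linear0.
Qed.

Lemma commuting_all_scalar (F : fieldType) n (z : 'M[F]_n) (j : 'I_n) :
  (forall y, z *m y = y *m z) -> z = (z j j)%:M.
Proof.
move=> cz; apply/matrixP=> k i; rewrite [RHS]mxE.
have := congr1 (fun M : 'M_n => M k j) (cz (delta_mx i j)).
rewrite !mxE (bigD1 i) //= big1 => [|l li]; last first.
  by rewrite mxE (negPf li) mulr0.
rewrite addr0 mxE !eqxx mulr1 => ->.
rewrite (bigD1 j) //= big1 => [|l lj]; last by rewrite mxE (negPf lj) andbF mul0r.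
by rewrite mxE eqxx andbT addr0 mulr_natl.
Qed.

(** In this section S is trace-nondegenerate in dimension at least 2, which
    turns out to be contradictory. *)
Section ScalarNilpotent.

Variables (F : fieldType) (n : nat) (S : mxset F n).
Hypotheses (n_gt1 : (1 < n)%N) (SM : mx_semigroup S).
Hypothesis Ssn : forall A, S A -> exists a, nilpotent_mx (A - a%:M).
Hypothesis ndS : trace_nondegenerate S.

Let n_gt0 : (0 < n)%N := ltnW n_gt1.

(** The trace of a scalar a plus a nilpotent is n a: if n = 0 in F, every trace
    on S vanishes and the identity matrix contradicts nondegeneracy. *)
Lemma trace_nondegenerate_natr_neq0 : n%:R != 0 :> F.
Proof.
apply/eqP=> n0; have /eqP : 1%:M = 0 :> 'M[F]_n.
  apply: ndS => A SA; have [a /mxtrace_scalar_nilpotent] := Ssn SA.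
  by rewrite mul1mx => ->; rewrite -mulr_natl n0 mul0r.
by rewrite -mxrank_eq0 mxrank1 eqn0Ngt n_gt0.
Qed.

(** The nilpotent members of S form an ideal J, since a member of S is nilpotent
    as soon as it is singular.  By the nilpotent case some v0 is killed by J.
    For A in J, a column y of A and s in S, the matrix s A lies in J, so
    tr (y v0 s) = v0 s y = 0, whence y v0 = 0 and y = 0. *)
Lemma trace_nondegenerate_nilpotent A : S A -> nilpotent_mx A -> A = 0.
Proof.
move=> SA nA; pose J B := S B /\ nilpotent_mx B.
have JMr B D : J B -> S D -> J (B *m D).
  move=> [SB nB] SD; have SBD := SM SB SD; split=> //.
  have [a na] := Ssn SBD.
  suff a0 : a = 0 by move: na; rewrite a0 raddf0 subr0.
  apply: scalar_nilpotent_singular na _.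
  by rewrite unitmx_mul negb_and (nilpotent_singular n_gt0 nB).
have JMl B D : S B -> J D -> J (B *m D).
  move=> SB JD; have [_ [k DBk]] := JMr _ _ JD SB; case: JD => SD _.
  split; first exact: SM.
  exists k.+1; have shift l : (B *m D) ^+ l.+1 = B *m (D *m B) ^+ l *m D.
    elim: l => [|l IHl]; first by rewrite expr0 mulmx1 expr1.
    by rewrite exprSr IHl exprSr -!mulmxE !mulmxA.
  by rewrite shift DBk mulmx0 mul0mx.
have [|B D [SB nB] [SD _]||v nzv vJ] := @idempotent_eigenvector n F 0 J n_gt0.
- by rewrite mul0r.
- by apply: JMr.
- by move=> B [_ nB]; rewrite raddf0 subr0.
have {}vJ B : J B -> v *m B = 0 by move/vJ; rewrite scale0r.
apply/eqP; apply: contraT => nzA.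
have [j nzj] : exists j, col j A != 0.
  have [j] : exists j, row j A^T != 0 by apply: row_neq0; rewrite trmx_eq0.
  by rewrite -tr_col trmx_eq0; exists j.
suff Av : col j A *m v = 0.
  have /rV0Pn[i nzi] := nzv; have /cV0Pn[k nzk] := nzj.
  have /eqP : (col j A *m v) k i = 0 by rewrite Av mxE.
  by rewrite mxE big_ord1 mulf_eq0 (negPf nzi) (negPf nzk).
apply: ndS => B SB; rewrite -mulmxA mxtrace_mulC colE mulmxA -(mulmxA v).
by rewrite vJ ?mul0mx ?mxtrace0 //; apply: JMl.
Qed.

(** Conjugation by the nonzero members of S preserves the space of trace-zero
    matrices, where the unipotent case provides a fixed vector z.  As z
    commutes with S, tr ((z y - y z) s) = 0 for all y, so z commutes with
    every y; but a scalar matrix of trace zero is zero when n is not. *)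
Lemma trace_nondegenerate_scalar_nilpotent : False.
Proof.
have unitS A : S A -> A != 0 -> A \in unitmx.
  move=> SA; apply: contraNT => sA; have [a nA] := Ssn SA.
  apply/eqP/trace_nondegenerate_nilpotent => //.
  have a0 := scalar_nilpotent_singular nA sA.
  by move: nA; rewrite a0 raddf0 subr0.
pose S' A := S A /\ A \in unitmx; pose T := mx_image (@conj_action F n) S'.
have [|a u v tru trv|W WP] :=
    @subspace_row_space F (n * n) (fun w => \tr (vec_mx w) = 0).
- by rewrite linear0 mxtrace0.
- by rewrite linearP /= mxtraceD mxtraceZ tru trv mulr0 addr0.
have WPmx X : (mxvec X <= W)%MS <-> \tr X = 0.
  by have := WP (mxvec X); rewrite mxvecK.
have [|_ [A [_ uA] ->]|||_ [A [SA uA] ->]|v [nzv /WP trv] vT] :=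
    @idempotent_eigenvector_in _ _ F 1 T W.
(* There are nonzero trace-zero matrices because [n > 1]. *)
- pose i0 := Ordinal n_gt0; pose i1 := Ordinal n_gt1.
  have : (mxvec (delta_mx i0 i1 : 'M[F]_n) <= W)%MS.
    apply/WPmx; rewrite /mxtrace big1 // => i _; rewrite mxE.
    by case: eqP => // ->.
  apply: contraTneq => ->; rewrite submx0 mxvec_eq0; apply/matrix0Pn.
  by exists i0, i1; rewrite mxE !eqxx oner_neq0.
- apply/row_subP=> i; rewrite row_mul -[row i W]vec_mxK mul_vec_conj.
  apply/WPmx; rewrite mxtrace_mulC mulmxA mulmxV // mul1mx.
  by apply/WP/row_sub.
- by rewrite mulr1.
- move=> _ _ [A [SA uA] ->] [B [SB uB] ->].
  exists (A *m B); last by rewrite conj_actionM.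
  by split; [apply: SM | rewrite unitmx_mul uA].
- by have [a] := Ssn SA; apply: conj_action_unipotent.
pose z := vec_mx v; have cz A : S A -> z *m A = A *m z.
  move=> SA; have [->|nzA] := eqVneq A 0; first by rewrite mulmx0 mul0mx.
  have uA := unitS A SA nzA.
  have : v *m conj_action A = 1 *: v by apply: vT; exists A.
  rewrite scale1r -[v in LHS]vec_mxK mul_vec_conj => /(canRL mxvecK).
  by rewrite -/z => zE; rewrite -[in RHS]zE !mulmxA mulmxV // mul1mx.
have {}cz y : z *m y = y *m z.
  apply/eqP; rewrite -subr_eq0; apply/eqP/ndS => A SA.
  by rewrite mulmxBl raddfB /= -!mulmxA (cz A SA) mxtrace_mulC -!mulmxA subrr.
case/negP: nzv; rewrite -vec_mx_eq0 -/z.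
have zE := commuting_all_scalar (Ordinal n_gt0) cz.
move: trv; rewrite -/z zE mxtrace_scalar -mulr_natl => /eqP.
rewrite mulf_eq0 (negPf trace_nondegenerate_natr_neq0) => /eqP->.
by rewrite raddf0.
Qed.

End ScalarNilpotent.

(** The theorem of Kaplansky.  Naming the eigenvalue through the decomposition
    of A, rather than only asserting that one exists, is what keeps it in the
    ground field while the vector is sought over an extension. *)
Lemma scalar_nilpotent_eigenvector n (F : fieldType) (S : mxset F n) :
  (0 < n)%N -> mx_semigroup S ->
  (forall A, S A -> exists a, nilpotent_mx (A - a%:M)) ->
  exists2 v : 'rV_n, v != 0 &
    forall A a, S A -> nilpotent_mx (A - a%:M) -> v *m A = a *: v.
Proof.
have [N] := ubnP n; elim: N n F S => // N IHN n F S ltnN n_gt0 SM Ssn.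
have [n_le1|n_gt1] := leqP n 1.
  have [v nzv] := rV_neq0 F n_gt0; exists v => // A a _ /nilpotent1->//.
  by rewrite mul_mx_scalar.
have [[L [f [m [W [sf nzW ltW WS]]]]]|ndS] := burnside n_gt1 SM; last first.
  by case: (trace_nondegenerate_scalar_nilpotent n_gt1 SM Ssn ndS).
have [SM' Snil' eigS] := restrict_eigenvectors SM WS.
have [|||v nzv vS] := IHN _ L _ _ _ SM'.
- by rewrite -ltnS (leq_trans _ ltnN).
- by rewrite lt0n mxrank_eq0.
- by move=> _ [A SA ->]; have [a nA] := Ssn A SA; exists (f a); apply: Snil'.
have [nzvW _ vW] := eigS v nzv.
have [w nzw wA] := separated_descent sf nzvW.
exists w => // A a SA nA; apply: wA; apply: vW => //; apply: vS; first by exists A.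
exact: Snil'.
Qed.

(** * Triangular form *)

(** The situation of the theorem, in a form that passes to subquotients:
    being killed by a product of factors A - r stands for having all
    eigenvalues in F. *)
Definition nilpotent_perturbation (F : fieldType) n (calA S : mxset F n) :=
  [/\ forall A B, calA A -> calA B -> comm_mx A B,
      forall A, calA A -> exists rs : seq F, \prod_(r <- rs) (A - r%:M) = 0,
      mx_semigroup S,
      forall T A, S T -> calA A -> comm_mx T A
    & forall T, S T -> exists2 A, calA A & nilpotent_mx (T - A)].

Lemma nilpotent_perturbation_image (F : fieldType) n k (calA S : mxset F n)
    (C : mxset F n) (phi : 'M[F]_n -> 'M[F]_k) :
  partial_rep idfun C phi -> (forall A, calA A -> C A) ->
  (forall T, S T -> C T) -> nilpotent_perturbation calA S ->
  nilpotent_perturbation (mx_image phi calA) (mx_image phi S).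
Proof.
move=> rep AC SC [comA splA SM comS Snil]; have [_ repB repM] := rep.
have comP A B : C A -> C B -> comm_mx A B -> comm_mx (phi A) (phi B).
  move=> CA CB cAB; rewrite /comm_mx; have [_ <-] := repM A B CA CB.
  by have [_ <-] := repM B A CB CA; rewrite cAB.
split=> [_ _ [A AA ->] [B AB ->]|_ [A AA ->]||_ _ [T ST ->] [A AA ->]|_ [T ST ->]].
- by apply: comP; [apply: AC | apply: AC | apply: comA].
- have [rs Ars] := splA A AA; exists rs.
  have [_] := partial_rep_prod rep rs (AC _ AA).
  by rewrite map_id Ars (partial_rep0 rep).
- exact: partial_rep_semigroup rep _ SC SM.
- by apply: comP; [apply: SC | apply: AC | apply: comS].
have [A AA nTA] := Snil T ST; exists (phi A); first by exists A.
have [CTA <-] := repB T A (SC _ ST) (AC _ AA).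
exact: (partial_rep_nilpotent rep CTA nTA).
Qed.

Lemma prod_mx_singular (F : fieldType) n (X : F -> 'M[F]_n) (rs : seq F) :
  (0 < n)%N -> \prod_(r <- rs) X r = 0 -> exists r, X r \notin unitmx.
Proof.
move=> n_gt0 X0; apply: NNPP => nr.
have uX r : X r \in unitmx by apply: contraT => sX; case: nr; exists r.
have n0 : nilpotent_mx (0 : 'M[F]_n) by exists 1%N; rewrite expr1.
apply: (negP (nilpotent_singular n_gt0 n0)); rewrite -X0.
elim/big_ind: _ => //; first exact: unitmx1.
by move=> A B uA uB; rewrite [_ * _ \in _]unitmx_mul uA.
Qed.

(** A nonscalar A in the commuting family has a singular A - r, whose kernel is
    invariant under all that commutes with A.  If the family is scalar,
    Kaplansky gives an invariant line. *)
Lemma nilpotent_perturbation_invariant (F : fieldType) n (calA S : mxset F n) :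
  (1 < n)%N -> nilpotent_perturbation calA S ->
  exists W : 'M[F]_n, [/\ W != 0, (\rank W < n)%N,
    forall A, calA A -> stablemx W A & forall T, S T -> stablemx W T].
Proof.
move=> n_gt1 [comA splA SM comS Snil]; have n_gt0 := ltnW n_gt1.
have [[A AA nscA]|scA] := classic (exists2 A, calA A & ~~ is_scalar_mx A).
  have [rs Ars] := splA A AA; have [r sAr] := prod_mx_singular n_gt0 Ars.
  have comK B : comm_mx B A -> stablemx (kermx (A - r%:M)) B.
    move=> cBA; apply: comm_mx_stable_ker; apply: comm_mx_sym.
    by apply: comm_mxB => //; apply: comm_mx_scalar.
  exists (kermx (A - r%:M)); split=> [||B AB|T ST].
  - by rewrite kermx_eq0 row_free_unit.
  - rewrite mxrank_ker ltn_subrL n_gt0 andbT lt0n mxrank_eq0 subr_eq0.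
    by apply: contraNneq nscA => ->; apply: scalar_mx_is_scalar.
  - by apply: comK; apply: comA.
  - by apply: comK; apply: comS.
have {}scA A : calA A -> exists a, A = a%:M.
  move=> AA; apply/is_scalar_mxP; apply: contraT => nscA.
  by case: scA; exists A.
have Ssn T : S T -> exists a, nilpotent_mx (T - a%:M).
  by move=> /Snil[A /scA[a ->]]; exists a.
have [v nzv vS] := scalar_nilpotent_eigenvector n_gt0 SM Ssn.
exists <<v>>%MS; split=> [||A /scA[a ->]|T ST].
- by rewrite -mxrank_eq0 genmxE mxrank_eq0.
- by rewrite genmxE rank_rV nzv.
- exact: stablemxC.
- have [a na] := Ssn T ST; rewrite (eqmx_stable _ (genmxE v)).
  by rewrite (vS T a ST na) scalemx_sub.
Qed.

(** The first k rows of the extended row basis of W span W, so invariance of W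
    means that those rows have no component on the others. *)
Lemma stable_row_ebase (F : fieldType) k m (W A : 'M[F]_(k + m)) :
  \rank W = k -> stablemx W A -> ursubmx (conjmx (row_ebase W) A) = 0.
Proof.
move=> rkW /submxP[D]; set P := row_ebase W; set Q := col_ebase W.
have uP : P \in unitmx := row_ebase_unit W.
have uQ : Q \in unitmx := col_ebase_unit W.
rewrite -(mulmx_ebase W) rkW -/P -/Q => WA.
pose E := invmx Q *m D *m Q.
have : pid_mx k *m conjmx P A = E *m (pid_mx k : 'M_(k + m)).
  rewrite conjumx // -[pid_mx k in LHS](mulKmx uQ) /E !mulmxA.
  rewrite -!mulmxA (mulmxA Q) (mulmxA _ P) (mulmxA _ A) WA.
  by rewrite -!mulmxA mulmxV // mulmx1.
rewrite -{1}[conjmx P A]submxK -[E]submxK pid_mx_block !mulmx_block.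
rewrite !mul0mx !mul1mx !mulmx0 !addr0.
by case/eq_block_mx.
Qed.

Definition lower_block (F : fieldType) k m (P : 'M[F]_(k + m)) :
  mxset F (k + m) := fun A => ursubmx (conjmx P A) = 0.

Lemma lower_blockE (F : fieldType) k m (P A : 'M[F]_(k + m)) :
  lower_block P A -> conjmx P A =
    block_mx (ulsubmx (conjmx P A)) 0 (dlsubmx (conjmx P A))
             (drsubmx (conjmx P A)).
Proof. by rewrite /lower_block => ur0; rewrite -[LHS]submxK ur0. Qed.

Lemma conjumxM (F : fieldType) n (P A B : 'M[F]_n) : P \in unitmx ->
  conjmx P (A *m B) = conjmx P A *m conjmx P B.
Proof. by move=> uP; rewrite conjmxM // inE stablemx_unit. Qed.

Lemma conjmxB (F : fieldType) n (P A B : 'M[F]_n) :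
  conjmx P (A - B) = conjmx P A - conjmx P B.
Proof. by rewrite /conjmx mulmxBr mulmxBl. Qed.

Lemma partial_rep_ul (F : fieldType) k m (P : 'M[F]_(k + m)) : P \in unitmx ->
  partial_rep idfun (lower_block P) (fun A => ulsubmx (conjmx P A)).
Proof.
move=> uP; split=> [a|A B LA LB|A B LA LB].
- rewrite /lower_block conjmx_scalar ?row_free_unit // scalar_mx_block.
  by rewrite block_mxKur block_mxKul.
- rewrite /lower_block conjmxB (lower_blockE LA) (lower_blockE LB).
  by rewrite opp_block_mx add_block_mx !block_mxKur !block_mxKul subr0.
- rewrite /lower_block conjumxM // (lower_blockE LA) (lower_blockE LB).
  rewrite mulmx_block !block_mxKur !block_mxKul.
  by rewrite !mulmx0 !mul0mx !addr0.
Qed.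

Lemma partial_rep_dr (F : fieldType) k m (P : 'M[F]_(k + m)) : P \in unitmx ->
  partial_rep idfun (lower_block P) (fun A => drsubmx (conjmx P A)).
Proof.
move=> uP; split=> [a|A B LA LB|A B LA LB].
- rewrite /lower_block conjmx_scalar ?row_free_unit // scalar_mx_block.
  by rewrite block_mxKur block_mxKdr.
- rewrite /lower_block conjmxB (lower_blockE LA) (lower_blockE LB).
  by rewrite opp_block_mx add_block_mx !block_mxKur !block_mxKdr subr0.
- rewrite /lower_block conjumxM // (lower_blockE LA) (lower_blockE LB).
  rewrite mulmx_block !block_mxKur !block_mxKdr.
  by rewrite !mulmx0 !mul0mx !addr0 !add0r.
Qed.

Lemma is_trig_small (F : fieldType) n (A : 'M[F]_n) :
  (n <= 1)%N -> is_trig_mx A.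
Proof.
move=> n_le1; apply/is_trig_mxP=> i j ltij.
by have := leq_trans (leq_ltn_trans (leq0n i) ltij) (leq_trans (ltn_ord j) n_le1).
Qed.

(** In a basis adapted to an invariant subspace the induction handles the two
    diagonal blocks separately; the block below the diagonal is free in a lower
    triangular form. *)
Lemma cotrigonalize (F : fieldType) n (calA S : mxset F n) :
  nilpotent_perturbation calA S ->
  exists2 P, P \in unitmx & forall T, S T -> is_trig_mx (conjmx P T).
Proof.
have [N] := ubnP n; elim: N n calA S => // N IHN n calA S ltnN npS.
have [n_le1|n_gt1] := leqP n 1.
  by exists 1%:M => [|T _]; [apply: unitmx1 | apply: is_trig_small].
have [W [nzW ltW AW SW]] := nilpotent_perturbation_invariant n_gt1 npS.
have [k [m [rkW nE]]] : exists k m, \rank W = k /\ n = (k + m)%N.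
  by exists (\rank W), (n - \rank W)%N; rewrite subnKC // ltnW.
have k_gt0 : (0 < k)%N by rewrite -rkW lt0n mxrank_eq0.
have m_gt0 : (0 < m)%N by move: ltW; rewrite rkW nE -[ltnLHS]addn0 ltn_add2l.
subst n; pose P := row_ebase W; have uP : P \in unitmx := row_ebase_unit W.
have CA A : calA A -> lower_block P A by move/AW/stable_row_ebase; apply.
have CS T : S T -> lower_block P T by move/SW/stable_row_ebase; apply.
have [|P1 uP1 trig1] := IHN k _ _ _
    (nilpotent_perturbation_image (partial_rep_ul uP) CA CS npS).
  by rewrite -ltnS (leq_trans _ ltnN) // ltnS -[ltnLHS]addn0 ltn_add2l.
have [|P2 uP2 trig2] := IHN m _ _ _
    (nilpotent_perturbation_image (partial_rep_dr uP) CA CS npS).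
  by rewrite -ltnS (leq_trans _ ltnN) // ltnS -[ltnLHS]add0n ltn_add2r.
pose B : 'M_(k + m) := block_mx P1 0 0 P2.
pose B' : 'M_(k + m) := block_mx (invmx P1) 0 0 (invmx P2).
have BB' : B *m B' = 1%:M.
  rewrite mulmx_block !mul0mx !mulmx0 !addr0 !add0r !mulmxV //.
  by rewrite -scalar_mx_block.
have [uB _] := mulmx1_unit BB'.
have BE : invmx B = B' by rewrite -[LHS]mulmx1 -BB' mulKmx.
exists (B *m P) => [|T ST]; first by rewrite unitmx_mul uB.
rewrite conjuMmx ?row_free_unit ?stablemx_unit // conjumx // BE.
rewrite (lower_blockE (CS T ST)) !mulmx_block.
rewrite !(mul0mx, mulmx0, addr0, add0r) is_trig_block_mx // eqxx /=.
rewrite -!conjumx //; apply/andP; split.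
- by apply: trig1; exists T.
- by apply: trig2; exists T.
Qed.

Lemma mulmx_sum_col (F : fieldType) m n (A : 'M[F]_(m, n)) (u : 'cV_n) :
  A *m u = \sum_i u i 0 *: col i A.
Proof.
apply/colP=> j; rewrite mxE summxE; apply: eq_bigr => i _.
by rewrite !mxE mulrC.
Qed.

(** For a lower triangular form it is the last columns of P^-1 that span
    invariant subspaces, hence the reversal of indices. *)
Lemma triangularizable_of_trig (F : fieldType) n (S : mxset F n) (P : 'M[F]_n) :
  P \in unitmx -> (forall T, S T -> is_trig_mx (conjmx P T)) ->
  triangularizable S.
Proof.
move=> uP trigS; pose b := [tuple col (rev_ord i) (invmx P) | i < n].
have bE (i : 'I_n) : b`_i = col (rev_ord i) (invmx P).
  by rewrite -tnth_nth tnth_mktuple.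
have freeb : free b.
  apply/freeP=> c sum0 i.
  have : \sum_i c i *: b`_i = invmx P *m \col_j c (rev_ord j).
    rewrite [RHS]mulmx_sum_col (reindex_inj rev_ord_inj).
    by apply: eq_bigr => j _; rewrite bE mxE rev_ordK.
  rewrite sum0 => /(congr1 (mulmx P)); rewrite mulKVmx // mulmx0.
  by move=> /colP/(_ (rev_ord i)); rewrite !mxE rev_ordK.
have sizeb : size b = n by rewrite size_tuple.
have sizet (j : 'I_n.+1) : size (take j b) = j.
  by rewrite size_takel // sizeb leq_ord.
pose V (j : 'I_n.+1) := <<take j b>>%VS.
exists V; split=> [|||j|A j v SA].
- by rewrite /V take0 span_nil.
- apply/eqP; rewrite eqEdim subvf /V take_oversize ?sizeb //.
  by rewrite (eqP freeb) sizeb dimvf /dim /= muln1.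
- move=> i j leij; apply: sub_span => x.
  by rewrite -(take_takel b leij); apply: mem_take.
- have : free (take j b).
    by apply: (@catl_free _ _ (drop j b)); rewrite cat_take_drop.
  by rewrite /free => /eqP->.
have VA : (linfun (mulmx A) @: V j <= V j)%VS.
  rewrite limg_span; apply/span_subvP => _ /mapP[_ /(nthP 0)[i ltij <-] ->].
  rewrite sizet in ltij.
  have ltin : (i < n)%N := leq_trans ltij (leq_ord j).
  rewrite nth_take // (bE (Ordinal ltin)) lfunE /=.
  set i' := rev_ord _.
  have -> : A *m col i' (invmx P) = invmx P *m col i' (conjmx P A).
    by rewrite conjumx // !colE !mulmxA mulVmx // mul1mx.
  rewrite mulmx_sum_col; apply: memv_suml => l _.
  have [ltli|leil] := ltnP l i'.
    have /is_trig_mxP/(_ l i' ltli) Xli := trigS A SA.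
    by rewrite [col _ _ _ _]mxE Xli scale0r mem0v.
  apply: memvZ; rewrite -(rev_ordK l) -bE; apply: memv_span.
  have ltj : (rev_ord l < j)%N.
    apply: leq_ltn_trans ltij; rewrite /= leq_subLR.
    by move: leil; rewrite /= leq_subLR addSn addnC -addSn addnC.
  by rewrite -(nth_take 0 ltj) mem_nth // sizet.
move=> vV; have := memv_img (linfun (mulmx A)) vV.
by rewrite lfunE => /(subvP VA).
Qed.

(** On each step U < U1 of the flag, A acts modulo U as a scalar r, so A - r
    maps U1 into U; the product of these factors kills the whole space. *)
Lemma triangularizable_split (F : fieldType) n (A : 'M[F]_n) :
  triangularizable_mx A -> exists rs : seq F, \prod_(r <- rs) (A - r%:M) = 0.
Proof.
move=> [V [V0 Vn Vmono Vdim VA]].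
suff kill j : (j <= n)%N -> exists rs : seq F, forall v, v \in V (inord j) ->
    \prod_(r <- rs) (A - r%:M) *m v = 0.
  have [rs killV] := kill n (leqnn n); exists rs; apply/matrixP=> k i.
  have En : inord n = ord_max :> 'I_n.+1 by apply: val_inj; rewrite /= inordK.
  have /colP/(_ k) : \prod_(r <- rs) (A - r%:M) *m delta_mx i 0 = 0 :> 'cV_n.
    by apply: killV; rewrite En Vn memvf.
  by rewrite -colE mxE => ->; rewrite !mxE.
elim: j => [_|j IHj ltjn].
  exists [::] => v; have -> : inord 0 = ord0 :> 'I_n.+1.
    by apply: val_inj; rewrite /= inordK.
  by rewrite V0 memv0 => /eqP->; rewrite mulmx0.
have [rs killV] := IHj (ltnW ltjn).
have jE : (inord j : 'I_n.+1) = j :> nat by rewrite inordK // leqW.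
have j1E : (inord j.+1 : 'I_n.+1) = j.+1 :> nat by rewrite inordK.
set U := V (inord j) in killV; set U1 := V (inord j.+1).
have leU : (U <= U1)%VS by apply: Vmono; rewrite jE j1E.
have dimU : \dim U = j by rewrite Vdim.
have dimU1 : \dim U1 = j.+1 by rewrite Vdim.
have /subvPn[u uU1 uU] : ~~ (U1 <= U)%VS.
  by apply/negP=> /dimvS; rewrite dimU dimU1 ltnn.
have U1E : U1 = (U + <[u]>)%VS.
  apply/eqP; rewrite eq_sym eqEdim subv_add leU -memvE uU1 /= dimU1 -dimU.
  rewrite ltnNge; apply: contra uU => ledim.
  have /eqP-> : U == (U + <[u]>)%VS by rewrite eqEdim addvSl ledim.
  by rewrite memvE addvSr.
have /memv_addP[w wU [_ /vlineP[r ->] Au]] : A *m u \in (U + <[u]>)%VS.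
  by rewrite -U1E; apply: VA.
exists (rs ++ [:: r]) => v; rewrite -/U1 U1E.
move=> /memv_addP[w' w'U [_ /vlineP[a ->] ->]].
rewrite big_cat big_seq1 /= -mulmxE -mulmxA killV //.
have -> : (A - r%:M) *m (w' + a *: u) = A *m w' - r *: w' + a *: w.
  rewrite mulmxBl !mulmxDr -!scalemxAr Au !mul_scalar_mx scalerDr.
  by rewrite opprD addrACA addrK.
by rewrite memvD ?memvZ // memvB ?memvZ //; apply: VA.
Qed.

Theorem theorem2p5 (n : nat) (F : fieldType) (calA S : mxset F n)
    (hA : commuting_triangularizable calA)
    (hS : mx_semigroup S)
    (hSform : forall T : 'M[F]_n, S T ->
       exists A N : 'M[F]_n,
         [/\ calA A, commutant calA N, nilpotent_mx N & T = A + N]) :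
  triangularizable S.
Proof.
case: hA => comA triA.
suff /cotrigonalize[P uP trigS] : nilpotent_perturbation calA S.
  exact: triangularizable_of_trig uP trigS.
split=> // [A /triA/triangularizable_split //|T B|T].
- move=> /hSform[A [N [AA cN _ ->]]] AB.
  by rewrite /comm_mx mulmxDl mulmxDr (comA A B) // (cN B).
- move=> /hSform[A [N [AA _ nN ->]]]; exists A => //.
  by rewrite [A + N]addrC addrK.
Qed.
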